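(* Let $h\geq 2$, and let $\mathbf{b}=(b_1,\ldots,b_h)$ be a vector of positive integers with $\gcd(b_1,\ldots,b_h)=1$. Suppose that there exist a prime $p$, an integer $H\geq 1$, and a set $T\subseteq\mathbb{Z}/H\mathbb{Z}$ such that the residues $v_p(b_1),\ldots,v_p(b_h)\pmod H$ are pairwise distinct and $$\mathbb{Z}/H\mathbb{Z}=\{v_p(b_1),\ldots,v_p(b_h)\}\oplus T.$$ Then there exist a set $A\subseteq\mathbb{N}$, a constant $C_{\mathbf{b}}>0$, and an integer $n_0=n_0(\mathbf{b})$ such that $$1\leq r_{A,\mathbf{b}}(n)\leq C_{\mathbf{b}}\qquad\text{for every integer } n\geq n_0.$$
   Context: $\mathbb{N}=\mathbb{Z}_{\geq 0}$. For $A\subseteq\mathbb{N}$ and $\mathbf{b}=(b_1,\ldots,b_h)$ a vector of positive integers, the representation function is $$r_{A,\mathbf{b}}(n):=\#\{(x_1,\ldots,x_h)\in A^h \mid b_1x_1+\cdots+b_hx_h=n\}.$$ For a prime $p$ and $n\neq 0$, $v_p(n)$ denotes the largest $k\geq 0$ such that $p^k\mid n$. For $S,T\subseteq\mathbb{Z}/H\mathbb{Z}$, one writes $\mathbb{Z}/H\mathbb{Z}=S\oplus T$ if every residue class modulo $H$ can be written uniquely in the form $s+t$ with $s\in S$ and $t\in T$. In the set $\{v_p(b_1),\ldots,v_p(b_h)\}$ the integers are regarded as residue classes modulo $H$. *)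

(* Defs.v *)
From HB Require Import structures.
From mathcomp Require Import all_boot all_order all_algebra.
From mathcomp Require Import finmap.
From mathcomp Require Import boolp classical_sets functions cardinality.

Set Implicit Arguments.
Unset Strict Implicit.
Unset Printing Implicit Defensive.

Local Open Scope classical_set_scope.

Definition representations (h : nat) (A : set nat) (b : 'I_h -> nat) (n : nat)
    : set {ffun 'I_h -> nat} :=
  [set x | (forall i, A (x i)) /\ \sum_(i < h) b i * x i = n].

(* [fset_set] is the empty set on infinite sets; [finite_representations]
   shows that this case does not occur when the [b i] are positive. *)
Definition repr_fun (h : nat) (A : set nat) (b : 'I_h -> nat) (n : nat) : nat :=
  #|` fset_set (representations A b n)|.

Lemma finite_representations (h : nat) (A : set nat) (b : 'I_h -> nat)
    (n : nat) :
  (forall i, 0 < b i) -> finite_set (representations A b n).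
Proof.
move=> b_gt0.
pose f (y : {ffun 'I_h -> 'I_n.+1}) := [ffun i => y i : nat].
apply: (@sub_finite_set _ _ (f @` [set: {ffun 'I_h -> 'I_n.+1}])); last first.
  exact/finite_image/finite_finset.
move=> x [_ xn]; exists [ffun i => inord (x i)] => //.
apply/ffunP => i; rewrite !ffunE inordK // ltnS -xn (bigD1 i) //=.
by rewrite (leq_trans _ (leq_addr _ _)) // leq_pmull.
Qed.

(* Z/HZ for H >= 1, carried by {0, .., H-1} with addition modulo H. The
   library's ['Z_H] is not used because ['Z_1] is Z/2Z. *)
Notation Zmod H := 'I_H.-1.+1.

Definition residue (H k : nat) : Zmod H := inZp k.

Definition direct_sum (G : finZmodType) (S T : {set G}) : Prop :=
  forall g : G, exists! st : G * G,
    [/\ st.1 \in S, st.2 \in T & (st.1 + st.2)%R = g].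

(* Main.v *)
Require Import Defs.
From HB Require Import structures.
From mathcomp Require Import all_boot all_order all_algebra.
From mathcomp Require Import finmap.
From mathcomp Require Import boolp classical_sets functions cardinality.
From mathcomp Require Import zify.

Set Implicit Arguments.
Unset Strict Implicit.

(** Write [b_i = p^(a_i) m_i] with [p] not dividing [m_i], and let [S] be the
    set of integers whose base-[p] digits sit at positions whose residue modulo
    [H] lies in [T].  The tiling puts every digit position in exactly one of the
    sets [a_i + T], so [sum c_i p^(a_i) s_i] with [s_i] in [S] determines the
    [s_i] whenever the [c_i] are prime to [p] (compare modulo successive powers
    of [p]), and when all [c_i] are [1] these sums reach every multiple of
    [p^L], [L] large.  With [M] the product of the [m_i], take
    [A = {u + (M / m_j) s | u < M p^L, s in S}]: as the [b_i] have gcd [1], the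
    [u]'s can be chosen so that [n - sum b_i u_i] is a multiple [M p^L q], and
    [p^L q = sum p^(a_i) s_i] then gives a representation of [n].  Conversely a
    representation is determined by the finitely many choices of [u] and [j]
    for each of its entries. *)

(** Equal remainders say that the base-[p] digit at position [k] is zero, in a form that feeds
    directly into congruences modulo powers of [p]. *)
Definition sparse (p H : nat) (T : {set Zmod H}) (s : nat) : Prop :=
  forall k, residue H k \notin T -> s %% p ^ k.+1 = s %% p ^ k.

Lemma residueD (H k l : nat) :
  residue H (k + l) = (residue H k + residue H l)%R.
Proof. by apply/val_inj; rewrite /= modnDm. Qed.

Lemma sparse0 (p H : nat) (T : {set Zmod H}) : sparse p T 0.
Proof. by move=> k _; rewrite !mod0n. Qed.

(** As [p ^ j.+1] divides [s], the new digit lies below all nonzero digits of [s] and no carry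
    occurs. *)
Lemma sparse_add_digit (p H : nat) (T : {set Zmod H}) (j d s : nat) :
  d < p -> residue H j \in T -> sparse p T s -> p ^ j.+1 %| s ->
  sparse p T (d * p ^ j + s).
Proof.
move=> dp jT Ss /dvdnP[r sr] k kT.
have [lt_kj|le_jk] := ltnP k j.
  have div0 l : l <= j -> (d * p ^ j + s) %% p ^ l = 0.
    move=> lj; apply/eqP; rewrite -/(p ^ l %| _) sr dvdn_add ?dvdn_mull //.
      exact: dvdn_exp2l.
    by apply: dvdn_exp2l; apply: leqW.
  by rewrite !div0 // ltnW.
have lt_jk : j < k.
  rewrite ltn_neqAle le_jk andbT; apply/eqP => ejk.
  by move: kT; rewrite -ejk jT.
have p_gt0 : 0 < p by apply: leq_ltn_trans dp.
have split l : j < l -> (d * p ^ j + s) %% p ^ l = d * p ^ j + s %% p ^ l.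
  move=> jl; rewrite -modnDmr modn_small // sr.
  rewrite -(subnKC jl) expnD [r * _]mulnC -muln_modr.
  have : r %% p ^ (l - j.+1) < p ^ (l - j.+1) by rewrite ltn_mod expn_gt0 p_gt0.
  rewrite expnSr; have : 0 < p ^ j by rewrite expn_gt0 p_gt0.
  move: (p ^ j) (p ^ (l - j.+1)) (r %% _) => P Q t P0 tQ.
  apply: (@leq_trans (P * p * t.+1)); last by rewrite leq_mul2l tQ orbT.
  by rewrite mulnS ltn_add2r mulnC ltn_pmul2l.
by rewrite !split ?(leqW lt_jk) // Ss.
Qed.

(** Both [a i + (k - a i)] and [a j + (k - a j)] decompose the residue of [k]; the bounds keep
    truncated subtraction exact. *)
Lemma position_unique (h H : nat) (a : 'I_h -> nat) (T : {set Zmod H})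
    (k : nat) (i j : 'I_h) :
  injective (fun i => residue H (a i)) ->
  direct_sum [set residue H (a i) | i : 'I_h] T ->
  a i <= k -> a j <= k ->
  residue H (k - a i) \in T -> residue H (k - a j) \in T -> i = j.
Proof.
move=> inj_a aT aik ajk iT jT; apply: inj_a.
have [st [_ st_uniq]] := aT (residue H k).
have is_st l : a l <= k -> residue H (k - a l) \in T ->
    st = (residue H (a l), residue H (k - a l)).
  move=> alk lT; apply: st_uniq; split=> //=; first exact: imset_f.
  by rewrite -residueD subnKC.
by have := is_st i aik iT; rewrite (is_st j ajk jT) => /(congr1 fst).
Qed.

Lemma position_exists (h H : nat) (a : 'I_h -> nat) (T : {set Zmod H})
    (k : nat) :
  direct_sum [set residue H (a i) | i : 'I_h] T ->
  (forall i, a i <= k) -> exists i, residue H (k - a i) \in T.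
Proof.
move=> aT ak; have [[s t] [[/= /imsetP[i _ ->] tT stk] _]] := aT (residue H k).
exists i; suff -> : residue H (k - a i) = t by [].
by move: stk; rewrite -{1}(subnKC (ak i)) residueD => /GRing.addrI.
Qed.

Lemma sparse_sum_inj (p h H : nat) (a c : 'I_h -> nat) (T : {set Zmod H})
    (s s' : 'I_h -> nat) :
  prime p -> injective (fun i => residue H (a i)) ->
  direct_sum [set residue H (a i) | i : 'I_h] T ->
  (forall i, coprime p (c i)) ->
  (forall i, sparse p T (s i)) -> (forall i, sparse p T (s' i)) ->
  \sum_i c i * p ^ a i * s i = \sum_i c i * p ^ a i * s' i ->
  forall i, s i = s' i.
Proof.
move=> p_pr inj_a aT c_p Ss Ss' E.
have p_gt0 := prime_gt0 p_pr.
(* Induction on [k], for all [i] at once; truncated subtraction makes the modulus 1 when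
   [k <= a i]. *)
have cong k i : s i = s' i %[mod p ^ (k - a i)].
  elim: k i => [|k IH] i; first by rewrite sub0n expn0 !modn1.
  have [le_ki|lt_ik] := ltnP k (a i).
    by rewrite (eqP (_ : k.+1 - a i == 0)) ?expn0 ?modn1 // subn_eq0.
  rewrite subSn //; have [iT|iT] := boolP (residue H (k - a i) \in T); last first.
    by rewrite Ss // Ss' // IH.
  (* Position [k] belongs to [i] alone: for any other [j], either [p ^ k.+1] divides [p ^ a j], or
     the digits of [s j] and [s' j] at [k - a j] vanish. *)
  have others j : j != i ->
      c j * p ^ a j * s j = c j * p ^ a j * s' j %[mod p ^ k.+1].
    move=> ji; have [le_kj|le_jk] := ltnP k (a j).
      by rewrite -!mulnA !(mulnCA (c j)) -(subnKC le_kj) expnD -!mulnA !modnMr.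
    have jT : residue H (k - a j) \notin T.
      by apply: contra ji => jT; apply/eqP/(position_unique inj_a aT le_jk lt_ik).
    rewrite -!mulnA; rewrite -(modnMmr (c j)) -[RHS](modnMmr (c j)).
    congr (_ * _ %% _).
    rewrite -(subnKC (leqW le_jk)) expnD -!muln_modr subSn //.
    by rewrite Ss // Ss' // IH.
  have others_sum : \sum_(j | j != i) c j * p ^ a j * s j
      = \sum_(j | j != i) c j * p ^ a j * s' j %[mod p ^ k.+1].
    by rewrite -modn_summ -[RHS]modn_summ; congr (_ %% _); apply: eq_bigr.
  move: E; rewrite (bigD1 i) //= [RHS](bigD1 i) //=.
  move=> /(congr1 (modn^~ (p ^ k.+1))) /eqP.
  rewrite -(modnDmr _ (\sum_(j | _) _)) others_sum modnDmr eqn_modDr.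
  rewrite -!mulnA -(subnKC (leqW lt_ik)) expnD subSn //.
  rewrite !(mulnCA (c i)) -!muln_modr eqn_pmul2l ?expn_gt0 ?p_gt0 // => E.
  apply/eqP; move: E.
  have [le_s|le_s] := leqP (s i) (s' i).
    move=> E; rewrite eq_sym; move: E; rewrite eq_sym !eqn_mod_dvd ?leq_mul2l ?le_s ?orbT //.
    by rewrite -mulnBr Gauss_dvdr // coprimeXl.
  have {}le_s := ltnW le_s.
  rewrite !eqn_mod_dvd ?leq_mul2l ?le_s ?orbT //.
  by rewrite -mulnBr Gauss_dvdr // coprimeXl.
(* This [k] makes the modulus exceed both numbers, so the congruence becomes an equality. *)
move=> i; have := cong (s i + s' i + a i) i; rewrite addnK.
have lt_exp : s i + s' i < p ^ (s i + s' i) by apply/ltn_expl/prime_gt1.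
by rewrite !modn_small //; apply: leq_ltn_trans lt_exp; rewrite ?leq_addr ?leq_addl.
Qed.

(** The digits of [q] are dealt out one by one: the lowest goes to an [i] with [k - a i] in [T], and
    [q %/ p] is treated at [k.+1]. The divisibility clause keeps the new digit below those supplied
    by induction. *)
Lemma sparse_sum_exists (p h H : nat) (a : 'I_h -> nat) (T : {set Zmod H})
    (k q : nat) :
  1 < p -> direct_sum [set residue H (a i) | i : 'I_h] T ->
  (forall i, a i <= k) ->
  exists s : 'I_h -> nat,
    [/\ forall i, sparse p T (s i), forall i, p ^ (k - a i) %| s i
      & \sum_i p ^ a i * s i = p ^ k * q].
Proof.
move=> p_gt1 aT; elim/ltn_ind: q k => q IH k ak.
have [->|q_gt0] := posnP q.
  exists (fun=> 0); split=> [i|i|]; [exact: sparse0|exact: dvdn0|].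
  by rewrite muln0 big1 // => i _; rewrite muln0.
have [s [Ss s_dvd s_sum]] :=
  IH _ (ltn_Pdiv p_gt1 q_gt0) k.+1 (fun i => leqW (ak i)).
have [i iT] := position_exists aT ak.
exists (fun j => if j == i then (q %% p) * p ^ (k - a i) + s i else s j).
split=> [j|j|].
- case: eqP => // _; apply: sparse_add_digit => //.
    by rewrite ltn_mod ltnW.
  by rewrite -subSn.
- have s_dvdW l : p ^ (k - a l) %| s l.
    by apply: dvdn_trans (s_dvd l); rewrite subSn // expnS dvdn_mull.
  by case: eqP => [->|//]; rewrite dvdn_add ?dvdn_mull.
- rewrite (bigD1 i) //= eqxx mulnDr -addnA.
  have -> : \sum_(j | j != i)
      p ^ a j * (if j == i then q %% p * p ^ (k - a i) + s i else s j)
      = \sum_(j | j != i) p ^ a j * s j.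
    by apply: eq_bigr => j /negbTE->.
  move: s_sum; rewrite (bigD1 i) //= => ->.
  rewrite mulnCA -expnD subnKC // expnSr -mulnA (mulnC p) (mulnC (q %% p)).
  by rewrite -mulnDr addnC -divn_eq.
Qed.

Lemma Bezout_bigop_mod (h W : nat) (b : 'I_h -> nat) :
  0 < W -> (forall i, 0 < b i) ->
  exists v : 'I_h -> nat,
    \sum_i b i * v i = \big[gcdn/0]_(i < h) b i %[mod W].
Proof.
move=> W_gt0; elim: h b => [|h IH] b b_gt0.
  by exists (fun=> 0); rewrite !big_ord0.
have [v Ev] := IH (fun i => b (lift ord0 i)) (fun i => b_gt0 _).
set g := \big[gcdn/0]_(i < h) b (lift ord0 i) in Ev.
have [x y Exy _] := egcdnP g (b_gt0 ord0).
(* [W.-1] acts as -1 modulo [W], turning the subtraction in Bezout's identity into an addition. *)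
exists (fun i => oapp (fun j => v j * (W.-1 * y)) x (unlift ord0 i)).
rewrite [in RHS]big_ord_recl -/g big_ord_recl unlift_none /=.
have -> : \sum_(i < h) b (lift ord0 i) *
    oapp (fun j => v j * (W.-1 * y)) x (unlift ord0 (lift ord0 i))
    = (\sum_(i < h) b (lift ord0 i) * v i) * (W.-1 * y).
  by rewrite big_distrl; apply: eq_bigr => i _; rewrite liftK /= mulnA.
rewrite -modnDmr -modnMml Ev modnMml modnDmr mulnC Exy.
have -> : y * g + gcdn (b ord0) g + g * (W.-1 * y)
    = gcdn (b ord0) g + (y * g) * W by rewrite -[in RHS](prednK W_gt0); nia.
by rewrite addnC modnMDl.
Qed.

Lemma card_fset_le_finType (K : choiceType) (F : finType) (X : {fset K})
    (f : K -> F) : {in X &, injective f} -> #|` X| <= #|F|.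
Proof.
move=> inj_f; rewrite -(size_map f) -(card_uniqP _) ?max_card //.
by rewrite map_inj_in_uniq.
Qed.

Theorem theorem1p2 (h : nat) (b : 'I_h -> nat)
    (h_ge2 : 2 <= h)
    (b_gt0 : forall i, 0 < b i)
    (b_gcd : \big[gcdn/0]_(i < h) b i = 1)
    (b_sum : exists (p H : nat) (T : {set Zmod H}),
      [/\ prime p, 1 <= H,
          injective (fun i => residue H (logn p (b i)))
        & direct_sum [set residue H (logn p (b i)) | i : 'I_h] T]) :
  exists (A : set nat) (C n0 : nat),
    0 < C /\ forall n, n0 <= n -> 1 <= repr_fun A b n <= C.
Proof.
move: b_sum => [p [H [T [p_pr _]]]].
pose a i := logn p (b i); pose m i := (b i)`_p^'.
move=> inj_a aT; have p_gt0 := prime_gt0 p_pr.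
have bE i : b i = m i * p ^ a i.
  by rewrite -{1}(partnC p (b_gt0 i)) p_part mulnC.
have m_p i : coprime p (m i) by rewrite prime_coprime // -p'natE // part_pnat.
have m_gt0 i : 0 < m i by apply: part_gt0.
pose w j := \prod_(i | i != j) m i; pose M := \prod_i m i.
have mw j : m j * w j = M by rewrite /M (bigD1 j).
have w_p j : coprime p (w j).
  apply: (big_ind (coprime p)) => [|x y|i _]; rewrite ?coprimen1 //.
  by rewrite coprimeMr => -> ->.
have w_gt0 j : 0 < w j by apply: prodn_gt0.
pose L := \sum_i a i; pose W := M * p ^ L.
have aL i : a i <= L by rewrite /L (bigD1 i) // leq_addr.
have W_gt0 : 0 < W by rewrite muln_gt0 prodn_gt0 // expn_gt0 p_gt0.
pose A : set nat := fun x => exists (c : 'I_W * 'I_h) (s : nat),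
  sparse p T s /\ x = c.1 + w c.2 * s.
(* [C] counts the choices of [u] and [j] for all entries; [n0] bounds [\sum_i b i * u i] whenever
   every [u i < W]. *)
pose C := #|{ffun 'I_h -> 'I_W * 'I_h}|; pose n0 := \sum_i b i * W.
have upper n : repr_fun A b n <= C.
  have code (x : {ffun 'I_h -> nat}) : exists c : {ffun 'I_h -> 'I_W * 'I_h},
      representations A b n x -> exists s : 'I_h -> nat,
      forall i, sparse p T (s i) /\ x i = (c i).1 + w (c i).2 * s i.
    have [Ax|nAx] := pselect (forall i, A (x i)); last first.
      by exists [ffun i => (Ordinal W_gt0, i)] => -[].
    have [c cP] := choice Ax; have [s sP] := choice cP.
    exists (finfun c) => _; exists s => i; rewrite ffunE; exact: sP.
  have [f fP] := choice code.
  apply: (@card_fset_le_finType _ _ _ f) => x y.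
  have fin := finite_representations A n b_gt0.
  rewrite !in_fset_set // !inE => Rx Ry fxy.
  have [s sP] := fP x Rx; have [s' sP'] := fP y Ry; rewrite -fxy in sP'.
  case: Rx Ry => _ Ex [_ Ey]; apply/ffunP => i.
  rewrite (sP i).2 (sP' i).2; congr (_ + _ * _); move: i.
  (* With a common code, the [u] parts of the two sums cancel, and the factors [w] join the [m i] in
     coefficients prime to [p]. *)
  apply: (@sparse_sum_inj p h H a (fun i => m i * w (f x i).2) T) => //.
  - by move=> i; rewrite coprimeMr m_p w_p.
  - by move=> i; case: (sP i).
  - by move=> i; case: (sP' i).
  have expand (z : {ffun 'I_h -> nat}) (t : 'I_h -> nat) :
      (forall i, z i = (f x i).1 + w (f x i).2 * t i) ->
      \sum_i b i * z i = \sum_i b i * (f x i).1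
        + \sum_i m i * w (f x i).2 * p ^ a i * t i.
    move=> zE; rewrite -big_split; apply: eq_bigr => i _ /=.
    by rewrite zE mulnDr bE; congr (_ + _); rewrite !mulnA; congr (_ * _); lia.
  have := etrans Ex (esym Ey).
  rewrite (expand x s) => [|i]; last by case: (sP i).
  rewrite (expand y s') => [|i]; last by case: (sP' i).
  exact: addnI.
have lower n : n0 <= n -> 0 < repr_fun A b n.
  move=> n0n; have [v vE] := Bezout_bigop_mod W_gt0 b_gt0.
  (* The Bezout coefficients for gcd 1 are scaled by [n] and reduced modulo [W]. *)
  pose u i : 'I_W := Ordinal (ltn_pmod (n * v i) W_gt0).
  have uE : \sum_i b i * u i = n %[mod W].
    rewrite -modn_summ.
    under eq_bigr do rewrite modnMmr mulnCA.
    by rewrite modn_summ -big_distrr /= -modnMmr vE b_gcd modnMmr muln1.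
  have un : \sum_i b i * u i <= n.
    by apply: leq_trans n0n; apply: leq_sum => i _; rewrite leq_mul2l ltnW ?orbT.
  have /dvdnP[q qE] : W %| n - \sum_i b i * u i.
    by rewrite -eqn_mod_dvd // uE.
  have [s [Ss _ sE]] := @sparse_sum_exists p h H a T L q (prime_gt1 p_pr) aT aL.
  (* Entry [i] uses [j = i], so that [b i * w i = M * p ^ a i] and [M] factors out of the sum. *)
  rewrite cardfs_gt0; apply/fset0Pn; exists [ffun i => u i + w i * s i].
  rewrite in_fset_set ?inE; last exact: finite_representations.
  split=> [i|]; first by exists (u i, i), (s i); rewrite ffunE.
  rewrite -[RHS](subnKC un) qE mulnCA (mulnC q) -sE.
  rewrite big_distrr -big_split; apply: eq_bigr => i _ /=.
  by rewrite ffunE mulnDr {2}bE -(mw i); congr (_ + _); lia.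
exists A, C, n0; split=> [|n n0n]; last by rewrite lower ?upper.
(* [C] is positive because [n0] itself has a representation. *)
exact: leq_trans (lower n0 (leqnn _)) (upper n0).
Qed.
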